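(* For every real number $\mu\in[1/2,1]$ there exist a probability distribution $q=(q_0,q_1)$ with $q_0^2+q_1^2=\mu$ and a set of three mutually equibiased bases (MEBs) of $\mathbb{C}^2$ associated with $q$.
   Context: Mutually equibiased bases: let $\mathcal{H}$ be a $d$-dimensional complex Hilbert space and $q=(q_0,\ldots,q_{d-1})$ a probability distribution. A set of $L$ orthonormal bases $\mathcal{B}^{(\alpha)}=\{|e_k^{(\alpha)}\rangle\}_{k=0}^{d-1}$, $\alpha=1,\ldots,L$, of $\mathcal{H}$ is called a set of mutually equibiased bases (MEBs) associated with $q$ if for every pair $\alpha\neq\beta$ there is a permutation $\sigma$ of $\{0,1,\ldots,d-1\}$ (which may depend on the pair $(\alpha,\beta)$) such that $$\mathrm{Tr}\big[P_k^{(\alpha)}P_l^{(\beta)}\big]=q_{\sigma(k)\oplus\sigma(l)}\qquad\text{for all }k,l\in\{0,\ldots,d-1\},$$ where $P_k^{(\alpha)}=|e_k^{(\alpha)}\rangle\langle e_k^{(\alpha)}|$ and $\oplus$ denotes addition modulo $d$. By convention $\mathcal{B}^{(1)}$ is the standard (computational) basis, and $\sigma$ is taken to be the identity when one of the two bases is the standard basis. The index of coincidence of $q$ is $\mu=\sum_{k=0}^{d-1}q_k^2$. Here $d=2$. *)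

(* Defs.v *)
From mathcomp Require Import all_boot all_order all_fingroup all_algebra.
From mathcomp Require Import reals complex.

Set Implicit Arguments.
Unset Strict Implicit.
Unset Printing Implicit Defensive.

Import Order.TTheory GRing.Theory Num.Theory.
Local Open Scope ring_scope.
Local Open Scope complex_scope.
Local Open Scope sesquilinear_scope.

(* The dimension is d = n.+1, so that on the index type 'I_n.+1 the ring_scope
   addition is addition modulo d.  Kets are column vectors. *)
Section MutuallyEquibiasedBases.
Variables (R : realType) (n : nat).
Implicit Types (q : 'I_n.+1 -> R) (e : 'I_n.+1 -> 'cV[R[i]]_n.+1).

Definition prob_distr q : Prop :=
  (forall k, 0 <= q k) /\ \sum_k q k = 1.

(* The inner product <u|v>, antilinear in u. *)
Definition braket (u v : 'cV[R[i]]_n.+1) : R[i] := (u ^t* *m v) 0 0.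

Definition orthonormal_basis e : Prop :=
  basis_of fullv (codom e) /\ forall k l, braket (e k) (e l) = (k == l)%:R.

Definition std_basis : 'I_n.+1 -> 'cV[R[i]]_n.+1 := fun k => delta_mx k 0.

Definition proj (u : 'cV[R[i]]_n.+1) : 'M[R[i]]_n.+1 := u *m u ^t*.

(* The family has L.+1 members, the one of index ord0 being the standard basis.
   The members are not required to be distinct: for q = (1, 0, ..., 0) and d <= 2
   the definition forces all of them to have the same projectors. *)
Definition mutually_equibiased (L : nat) q
    (B : 'I_L.+1 -> 'I_n.+1 -> 'cV[R[i]]_n.+1) : Prop :=
  [/\ forall a, orthonormal_basis (B a),
      B ord0 =1 std_basis &
      forall a b, a != b ->
        exists sigma : 'S_n.+1,
          (B a =1 std_basis \/ B b =1 std_basis -> sigma = 1%g) /\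
          forall k l,
            \tr (proj (B a k) *m proj (B b l)) = (q (sigma k + sigma l))%:C].

End MutuallyEquibiasedBases.

(* Main.v *)
Require Import Defs.
From mathcomp Require Import all_boot all_order all_fingroup all_algebra.
From mathcomp Require Import reals complex.
From mathcomp Require Import ring lra.

Import Order.TTheory GRing.Theory Num.Theory.
Local Open Scope ring_scope.

(** For d = 2, equibiasedness with trivial permutations says that the Bloch
    vectors of the first elements of the bases have pairwise inner product
    [c = q 0 - q 1], where [c ^+ 2 = 2 * mu - 1].  Three unit vectors of R^3 with
    this property exist for every [c >= 0]: the pole, and two vectors of height
    [c] whose longitudes differ by an angle of cosine [c / (1 + c)]. *)

Lemma braketE (R : realType) (n : nat) (u v : 'cV[R[i]]_n.+1) :
  braket u v = \sum_j conjc (u j 0) * v j 0.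
Proof. by rewrite /braket mxE; apply: eq_bigr => j _; rewrite !mxE. Qed.

Lemma braket_linear_combination (R : realType) (n m : nat) (u : 'cV[R[i]]_n.+1)
    (c : 'I_m -> R[i]) (v : 'I_m -> 'cV[R[i]]_n.+1) :
  braket u (\sum_j c j *: v j) = \sum_j c j * braket u (v j).
Proof.
rewrite /braket mulmx_sumr summxE; apply: eq_bigr => j _.
by rewrite -scalemxAr mxE.
Qed.

(** Pairing a vanishing combination with [e i] isolates its coefficient [c i], so the family is
    free; having as many members as the dimension, it spans. *)
Lemma orthonormal_basis_of_braket (R : realType) (n : nat)
    (e : 'I_n.+1 -> 'cV[R[i]]_n.+1) :
  (forall k l, braket (e k) (e l) = (k == l)%:R) -> orthonormal_basis e.
Proof.
move=> he; split=> //.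
have sz : size (codom e) = n.+1 by rewrite size_codom card_ord.
rewrite basisEfree subvf sz dimvf /dim /= muln1 leqnn !andbT.
suff: free (Tuple (introT eqP sz)) by [].
apply/freeP => c /= sum0 i.
have nth_e (j : 'I_n.+1) : (codom e)`_j = e j.
  by rewrite codomE (nth_map ord0) ?size_enum_ord // nth_ord_enum.
have : braket (e i) (\sum_j c j *: (codom e)`_j) = c i.
  rewrite braket_linear_combination (bigD1 i) //= big1 => [|j ji].
    by rewrite nth_e he eqxx mulr1 addr0.
  by rewrite nth_e he eq_sym (negPf ji) mulr0.
by rewrite sum0 /braket mulmx0 mxE => <-.
Qed.

Lemma mxtrace_proj_mul (R : realType) (n : nat) (u v : 'cV[R[i]]_n.+1) :
  \tr (proj u *m proj v) = braket u v * braket v u.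
Proof.
rewrite /proj mulmxA mxtrace_mulC !mulmxA -mulmxA.
by rewrite /mxtrace big_ord1 mxE big_ord1 mulrC.
Qed.

(* The first element has Bloch vector
   [(2 * a * b * x, 2 * a * b * y, a ^+ 2 - b ^+ 2)]. *)
Definition qubit_basis (R : realType) (a b x y : R) (k : 'I_2) : 'cV[R[i]]_2 :=
  \col_j (if k == 0 then (if j == 0 then (a +i* 0)%C else (b * x +i* (b * y))%C)
          else (if j == 0 then (- b +i* 0)%C else (a * x +i* (a * y))%C)).

Lemma ord2P (P : 'I_2 -> Prop) : P 0 -> P 1 -> forall k, P k.
Proof.
move=> P0 P1 [[|[|//]] lt_k].
  by rewrite (_ : Ordinal lt_k = 0) //; apply: val_inj.
by rewrite (_ : Ordinal lt_k = 1) //; apply: val_inj.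
Qed.

Lemma qubit_basis_std (R : realType) : qubit_basis R 1 0 1 0 =1 @std_basis R 1.
Proof.
by apply: ord2P; apply/matrixP => i j; rewrite !mxE ord1 andbT;
  move: i; apply: ord2P; rewrite /= ?oppr0 ?mulr0 ?mulr1.
Qed.

Lemma qubit_basis_orthonormal (R : realType) (a b x y : R) :
  a ^+ 2 + b ^+ 2 = 1 -> x ^+ 2 + y ^+ 2 = 1 ->
  orthonormal_basis (qubit_basis R a b x y).
Proof.
move=> hab hxy; apply: orthonormal_basis_of_braket.
(* The nonlinear consequences of [hxy] that make the norms and the cross terms linear goals. *)
have na : a ^+ 2 + b ^+ 2 * (x ^+ 2 + y ^+ 2) = 1 by rewrite hxy mulr1.
have nb : b ^+ 2 + a ^+ 2 * (x ^+ 2 + y ^+ 2) = 1 by rewrite hxy mulr1 addrC.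
have ab : a * b * (x ^+ 2 + y ^+ 2) = a * b by rewrite hxy mulr1.
by apply: ord2P; apply: ord2P; rewrite braketE big_ord_recl big_ord1 !mxE /=;
  apply/eqP; rewrite eq_complex /=; apply/andP; split; apply/eqP;
  lra.
Qed.

(** The last hypothesis is the case [k = l = 0]: its left side is the squared modulus of [a * a' + b
    * b' * (x - i y) * (x' + i y')]. Normalization then fixes the other three overlaps, since the
    overlap matrix is doubly stochastic. *)
Lemma qubit_basis_equibiased (R : realType) (q : 'I_2 -> R)
    (a b x y a' b' x' y' : R) :
  a ^+ 2 + b ^+ 2 = 1 -> x ^+ 2 + y ^+ 2 = 1 ->
  a' ^+ 2 + b' ^+ 2 = 1 -> x' ^+ 2 + y' ^+ 2 = 1 ->
  q 0 + q 1 = 1 ->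
  a ^+ 2 * a' ^+ 2 + b ^+ 2 * b' ^+ 2
    + 2 * (a * b) * (a' * b') * (x * x' + y * y') = q 0 ->
  forall k l,
    \tr (proj (qubit_basis R a b x y k) *m proj (qubit_basis R a' b' x' y' l))
      = (q (k + l))%:C%C.
Proof.
move=> hab hxy hab' hxy' hq h0.
have xy1 : (x ^+ 2 + y ^+ 2) * (x' ^+ 2 + y' ^+ 2) = 1 by rewrite hxy hxy' mulr1.
have ab1 : (a ^+ 2 + b ^+ 2) * (a' ^+ 2 + b' ^+ 2) = 1 by rewrite hab hab' mulr1.
have aa : a ^+ 2 * a' ^+ 2 * ((x ^+ 2 + y ^+ 2) * (x' ^+ 2 + y' ^+ 2))
  = a ^+ 2 * a' ^+ 2 by rewrite xy1 mulr1.
have bb : b ^+ 2 * b' ^+ 2 * ((x ^+ 2 + y ^+ 2) * (x' ^+ 2 + y' ^+ 2))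
  = b ^+ 2 * b' ^+ 2 by rewrite xy1 mulr1.
have ab : a ^+ 2 * b' ^+ 2 * ((x ^+ 2 + y ^+ 2) * (x' ^+ 2 + y' ^+ 2))
  = a ^+ 2 * b' ^+ 2 by rewrite xy1 mulr1.
have ba : b ^+ 2 * a' ^+ 2 * ((x ^+ 2 + y ^+ 2) * (x' ^+ 2 + y' ^+ 2))
  = b ^+ 2 * a' ^+ 2 by rewrite xy1 mulr1.
have e11 : 1 + 1 = 0 :> 'I_2 by apply: val_inj.
by apply: ord2P; apply: ord2P; rewrite ?(add0r, addr0, e11) mxtrace_proj_mul
  !braketE !big_ord_recl !big_ord0 !mxE /=;
  apply/eqP; rewrite eq_complex /=; apply/andP; split; apply/eqP;
  lra.
Qed.

Theorem mainTheorem1 (R : realType) (mu : R) (hmu : 1 / 2 <= mu <= 1) :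
  exists q : 'I_2 -> R,
    prob_distr q /\ q 0 ^+ 2 + q 1 ^+ 2 = mu /\
    exists B : 'I_3 -> 'I_2 -> 'cV[R[i]]_2, mutually_equibiased q B.
Proof.
case/andP: hmu => hmu1 hmu2.
(* With [q 0 + q 1 = 1] and [c = q 0 - q 1], the sum of squares is [(1 + c ^+ 2) / 2]. *)
pose c := Num.sqrt (2 * mu - 1).
have c2 : c ^+ 2 = 2 * mu - 1 by rewrite sqr_sqrtr //; lra.
have c0 : 0 <= c := sqrtr_ge0 _.
have c1 : c <= 1 by nra.
pose q (k : 'I_2) : R := if k == 0 then (1 + c) / 2 else (1 - c) / 2.
pose a := Num.sqrt (q 0); pose b := Num.sqrt (q 1).
have q0 : q 0 = (1 + c) / 2 by [].
have q1 : q 1 = (1 - c) / 2 by [].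
have a2 : a ^+ 2 = (1 + c) / 2 by rewrite sqr_sqrtr // q0; lra.
have b2 : b ^+ 2 = (1 - c) / 2 by rewrite sqr_sqrtr // q1; lra.
(* Heights [c] and relative longitude of cosine [x] give the Bloch inner product
   [c ^+ 2 + (1 - c ^+ 2) * x]; equating it to [c] and cancelling [1 - c] gives this [x], still
   defined at [c = 1]. *)
pose x := c / (1 + c); pose y := Num.sqrt (1 - x ^+ 2).
have hx : x * (1 + c) = c by rewrite /x divfK // gt_eqF //; lra.
have x01 : 0 <= x <= 1.
  by rewrite /x divr_ge0 ?ler_pdivrMr /=; lra.
have xy : x ^+ 2 + y ^+ 2 = 1 by rewrite sqr_sqrtr ?subrKC //; nra.
have ab : a ^+ 2 + b ^+ 2 = 1 by rewrite a2 b2; lra.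
have q01 : q 0 + q 1 = 1 by rewrite q0 q1; lra.
have overlap : a ^+ 2 * a ^+ 2 + b ^+ 2 * b ^+ 2
    + 2 * (a * b) * (a * b) * x = q 0.
  rewrite (_ : 2 * (a * b) * (a * b) * x = 2 * (a ^+ 2 * b ^+ 2) * x); last by ring.
  rewrite a2 b2 q0.
  (* The products [a ^+ 2 * b ^+ 2] contribute the factor [(1 + c) * (1 - c)]. *)
  have : x * (1 + c) * (1 - c) = c * (1 - c) by rewrite hx.
  lra.
exists q; split; first split.
- by apply: ord2P; rewrite ?q0 ?q1; lra.
- by rewrite big_ord_recl big_ord1.
split; first by rewrite q0 q1; lra.
pose B (j : 'I_3) := match val j with
  | 0 => qubit_basis R 1 0 1 0
  | 1 => qubit_basis R a b 1 0
  | _ => qubit_basis R a b x y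
  end.
exists B; split.
- by case=> [[|[|[|//]]] ?]; apply: qubit_basis_orthonormal => //; lra.
- exact: qubit_basis_std.
(* The identity serves every pair, so the convention on the standard basis holds at once. *)
move=> i j neq_ij; exists 1%g; split=> // k l; rewrite !perm1.
move: i j neq_ij.
case=> [[|[|[|//]]] ?]; case=> [[|[|[|//]]] ?] //= _;
  apply: qubit_basis_equibiased => //; lra.
Qed.
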